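(* Let $C\subseteq\mathbb{R}^n$ be a convex set, $S\subseteq C$ a non-empty subset, and $A:\mathcal{F}(C;S)\to\{\text{true},\text{false}\}$ a statement about elements of $\mathcal{F}(C;S)$. Suppose that: 1. $A(\mathbb{R}^n)$ holds; 2. for all $U\in\mathcal{F}(C;S)$ and all $v\in N_C^U(S)$, $A(U)$ implies $A(U\cap v^\perp)$. Then $A(V)$ holds for all $V\in\mathcal{F}(C;S)$.
   Context: $A\pm B=\{a\pm b\mid a\in A,b\in B\}$ for sets; $v^\perp$ is the orthogonal complement of $v$. For $C\subseteq\mathbb{R}^n$ convex and $S\subseteq C$ non-empty, $\mathcal{F}(C;S)$ is the set of all linear subspaces $U\subseteq\mathbb{R}^n$ (called supporting subspaces of $C$ at $S$) such that (1) $S-S\subseteq U$ and (2) $C\setminus(U+S)$ is convex. Nested normal cone: for a linear subspace $U\subseteq\mathbb{R}^n$ with $S-S\subseteq U$, $$N_C^U(S):=\{v\in U\mid \forall c\in C\cap(U+S),\ \forall s\in S,\ \langle c-s,v\rangle\le 0\}.$$ (For $U\in\mathcal{F}(C;S)$ and $v\in N_C^U(S)$ one has $U\cap v^\perp\in\mathcal{F}(C;S)$, so $A(U\cap v^\perp)$ makes sense.) *)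

(* Defs.v *)
From HB Require Import structures.
From mathcomp Require Import all_boot all_order all_algebra.
From mathcomp Require Import boolp classical_sets reals convex.

Set Implicit Arguments.
Unset Strict Implicit.
Unset Printing Implicit Defensive.

Import Order.TTheory GRing.Theory Num.Theory.

Local Open Scope classical_set_scope.
Local Open Scope ring_scope.

Section SupportingSubspaces.
Context {R : realType} {n : nat}.
Implicit Types (A B C S : set 'rV[R]_n) (U : {vspace 'rV[R]_n}) (v : 'rV[R]_n).

Definition set_sum A B : set 'rV[R]_n := [set a + b | a in A & b in B].
Definition set_diff A B : set 'rV[R]_n := [set a - b | a in A & b in B].

Definition dot (u v : 'rV[R]_n) : R := (u *m v^T) 0 0.

(* [mulmxr v^T] maps [u] to the 1 x 1 matrix with entry [dot u v], so its
   kernel is the orthogonal complement of [v] as a subspace; see [mem_orthv]. *)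
Definition orthv v : {vspace 'rV[R]_n} := lker (linfun (mulmxr v^T)).

Lemma mem_orthv u v : (u \in orthv v) = (dot u v == 0).
Proof.
rewrite memv_ker lfunE /= /dot; apply/eqP/eqP => [->|uv0]; first by rewrite mxE.
by apply/matrixP => i j; rewrite !ord1 uv0 mxE.
Qed.

Definition supporting_subspaces C S : set {vspace 'rV[R]_n} :=
  [set U | set_diff S S `<=` [set` U] /\
           convex_set (C `\` set_sum [set` U] S)].

(* The paper only considers this when [set_diff S S `<=` [set` U]]. *)
Definition nested_normal_cone C U S : set 'rV[R]_n :=
  [set v | v \in U /\
     forall c, (C `&` set_sum [set` U] S) c ->
     forall s, S s -> dot (c - s) v <= 0].

End SupportingSubspaces.

(* Main.v *)
Require Import Defs.
From HB Require Import structures.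
From mathcomp Require Import all_boot all_order all_algebra.
From mathcomp Require Import boolp classical_sets reals convex.
From mathcomp Require Import interval_inference lra.

(** The supporting subspace [V] is reached from the whole space by cutting with
normals one at a time: as long as the current [U] strictly contains [V], some
nonzero [v] of the normal cone of [C] at [S] within [U] is orthogonal to [V]
([exists_normal_descent]).  Then [U :&: orthv v] is again supporting
([supporting_cap_orthv]), still contains [V], and has smaller dimension, so
finitely many steps end at [V].

Such a [v] comes from a separation theorem.  Fix [s0] in [S].  Since [V] is
supporting, the part of [C - s0] lying in [U] but not in [V] is a convex set
[K] that misses [V]; a nonzero functional vanishing on [V] and of constant
sign on [K] is, when written as the scalar product with an element of [U], the
normal that is sought.

No closedness or openness of [K] is available, so the separation is proved
algebraically.  Let [W] be a maximal subspace that contains [V] and misses [K]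
([maximal_disjoint_subspace]).  Maximality says exactly that the convex cone
[W + cone K] is total: it contains [x] or [- x] for every [x].  A proper total
convex cone in finite dimension is an order with an order unit [e], for which
[x |-> sup {t | t *: e <= x}] is a nonzero linear functional that is
nonnegative on the cone ([total_cone_functional]).  It vanishes on [W], since
[W] lies in the cone together with its opposite. *)

Set Implicit Arguments.
Unset Strict Implicit.
Unset Printing Implicit Defensive.

Import Order.TTheory GRing.Theory Num.Theory.

Local Open Scope classical_set_scope.
Local Open Scope ring_scope.

(** * Total convex cones *)

Section TotalCone.
Context {R : realType} {E : vectType R} (Q : set E).
Hypothesis QD : forall x y, Q x -> Q y -> Q (x + y).
Hypothesis QZ : forall a x, 0 <= a -> Q x -> Q (a *: x).
Hypothesis Q_total : forall x, Q x \/ Q (- x).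

(** Flipping signs in a basis makes all its vectors lie in [Q]; their sum then
dominates any vector once scaled by the sum of the absolute values of the
coordinates. *)
Lemma total_cone_order_unit :
  exists e, forall x, exists2 M, 0 <= M & Q (M *: e - x).
Proof.
have Q0 : Q 0 by case: (Q_total 0); rewrite ?oppr0.
pose b i := (vbasis {:E})`_i.
pose y i := if `[< Q (b i) >] then b i else - b i.
have Qy i : Q (y i).
  by rewrite /y; case: asboolP => // nQ; case: (Q_total (b i)).
exists (\sum_(i < \dim {:E}) y i) => x.
pose c i := coord (vbasis {:E}) i x.
have c_le i : `|c i| <= \sum_j `|c j|.
  by rewrite (bigD1 i)//= lerDl sumr_ge0.
exists (\sum_i `|c i|); first exact: sumr_ge0.
rewrite [X in _ - X](coord_vbasis (memvf x)) scaler_sumr -sumrB.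
elim/big_ind: _ => // i _; rewrite -/(c i) -/(b i).
have := c_le i; rewrite ler_norml => /andP[cl cr].
have := Qy i; rewrite /y; case: asboolP => _ Qyi.
  by rewrite -scalerBl; apply: QZ; rewrite ?subr_ge0.
by rewrite scalerN -opprD -scalerDl -scalerN; apply: QZ; rewrite // -lerBlDl sub0r.
Qed.

(** For the preorder [x <= y] given by [Q (y - x)], the functional is the
Dedekind cut of [x] along the order unit [e].  For a general cone this supremum
is only superadditive; totality also makes it the infimum of the [t] with
[x <= t *: e], hence subadditive. *)
Lemma total_cone_functional :
  (exists x, ~ Q x) ->
  exists2 f : {scalar E}, (forall x, Q x -> 0 <= f x) & exists e, f e != 0.
Proof.
move=> [x0 nQx0]; have [e unit_e] := total_cone_order_unit.
have nQNe : ~ Q (- e).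
  move=> QNe; have [M M0 QM] := unit_e (- x0); apply: nQx0.
  have -> : x0 = M *: (- e) + (M *: e - - x0).
    by rewrite scalerN opprK addKr.
  by apply: QD => //; apply: QZ.
have Qe : Q e by case: (Q_total e).
pose cut x := [set t | Q (x - t *: e)].
have cut_le x t r : Q (x - t *: e) -> Q (r *: e - x) -> t <= r.
  move=> Qt Qr; rewrite leNgt; apply/negP => lt_rt; apply: nQNe.
  have tr : t - r != 0 by rewrite subr_eq0 gt_eqF.
  have -> : - e = (t - r)^-1 *: ((r *: e - x) + (x - t *: e)).
    by rewrite subrKA -scalerBl -(opprB t) scaleNr scalerN scalerA mulVf ?scale1r.
  by apply: QZ; [rewrite invr_ge0 subr_ge0 ltW | apply: QD].
have cut_sup x : has_sup (cut x).
  split.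
    have [M _ QM] := unit_e (- x); exists (- M).
    by rewrite /cut /= scaleNr opprK addrC -[x in _ + x]opprK.
  by have [M _ QM] := unit_e x; exists M => t /= Qt; apply: cut_le QM.
pose f x := sup (cut x).
have f_ge x r : Q (x - r *: e) -> r <= f x.
  by move=> Qr; apply: ub_le_sup => //; case: (cut_sup x).
have f_le x r : Q (r *: e - x) -> f x <= r.
  move=> Qr; apply: ge_sup; first by case: (cut_sup x).
  by move=> t /= Qt; apply: cut_le Qr.
(* Totality turns both bounds into equivalences, up to an arbitrarily small
   error: this is what makes [f] both sub- and superadditive. *)
have lt_f x r : r < f x -> Q (x - r *: e).
  move=> r_lt; case: (Q_total (x - r *: e)) => //.
  by rewrite opprB => /f_le; rewrite leNgt r_lt.
have f_lt x r : f x < r -> Q (r *: e - x).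
  move=> lt_r; case: (Q_total (r *: e - x)) => //.
  by rewrite opprB => /f_ge; rewrite leNgt lt_r.
have fD x y : f (x + y) = f x + f y.
  apply/eqP; rewrite eq_le; apply/andP; split; apply/ler_addgt0Pl => d d0.
    apply: f_le.
    have -> : (d + (f x + f y)) *: e - (x + y) =
        ((f x + d / 2) *: e - x) + ((f y + d / 2) *: e - y).
      by rewrite addrACA -scalerDl opprD; congr (_ *: _ + _); lra.
    by apply: QD; apply: f_lt; rewrite ltrDl divr_gt0.
  rewrite -lerBlDl; apply: f_ge.
  have -> : x + y - (f x + f y - d) *: e =
      (x - (f x - d / 2) *: e) + (y - (f y - d / 2) *: e).
    by rewrite addrACA -opprD -scalerDl; congr (_ - _ *: _); lra.
  by apply: QD; apply: lt_f; rewrite gtrBl divr_gt0.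
have f0 : f 0 = 0 by apply: (addrI (f 0)); rewrite -fD !addr0.
have fN x : f (- x) = - f x.
  by apply/eqP; rewrite -addr_eq0 -fD addNr f0.
have fZ_gt0 a x : 0 < a -> f (a *: x) = a * f x.
  move=> a0; apply/eqP; rewrite eq_le; apply/andP; split.
    rewrite -ler_pdivrMl //; apply/ler_addgt0Pl => d d0.
    rewrite ler_pdivrMl //; apply: f_le.
    rewrite -scalerA -scalerBr; apply: QZ; first exact: ltW.
    by apply: f_lt; rewrite ltrDr.
  rewrite -ler_pdivlMl //; apply/ler_addgt0Pl => d d0.
  rewrite -lerBlDl ler_pdivlMl //; apply: f_ge.
  rewrite -scalerA -scalerBr; apply: QZ; first exact: ltW.
  by apply: lt_f; rewrite gtrBl.
have f_lin : linear_for *%R f.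
  move=> a x y; rewrite fD; congr (_ + _).
  have [a0|a0|->] := ltrgt0P a; last by rewrite scale0r mul0r.
    exact: fZ_gt0.
  by apply: oppr_inj; rewrite -fN -scaleNr fZ_gt0 ?mulNr ?oppr_gt0.
pose f_isLin := GRing.isLinear.Build _ _ _ _ f f_lin.
pose F : {scalar E} := HB.pack f f_isLin.
exists F => [x Qx|]; first by apply: f_ge; rewrite scale0r subr0.
exists e; rewrite gt_eqF//; apply: (lt_le_trans ltr01).
by apply: f_ge; rewrite scale1r subrr -(scale0r e); apply: QZ.
Qed.

End TotalCone.
(** * Separation of a convex set from a subspace *)

Lemma convex_setP {R : realType} {E : lmodType R} (K : set E) :
  convex_set K <->
  forall x y (t : R), 0 < t < 1 -> K x -> K y -> K (t *: x + (1 - t) *: y).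
Proof.
rewrite convex_setW; split=> [cK x y t /andP[t0 t1] Kx Ky|cK x y].
  apply: set_mem.
  exact: (cK x y (mem_set Kx) (mem_set Ky) (Itv01 (ltW t0) (ltW t1)) t0 t1).
move=> /set_mem Kx /set_mem Ky t t0 t1; apply: mem_set.
by apply: (cK x y t%:num _ Kx Ky); rewrite t0 t1.
Qed.

Lemma convex_comb {R : realType} {E : lmodType R} (K : set E) x y (a b : R) :
  convex_set K -> K x -> K y -> 0 <= a -> 0 <= b -> 0 < a + b ->
  exists2 z, K z & a *: x + b *: y = (a + b) *: z.
Proof.
move=> cK Kx Ky a0 b0 ab; pose t := a / (a + b).
have t0 : 0 <= t by rewrite divr_ge0 // ltW.
have t1 : t <= 1 by rewrite ler_pdivrMr// mul1r lerDl.
exists (t *: x + (1 - t) *: y).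
  exact: set_mem (cK x y (Itv01 t0 t1) (mem_set Kx) (mem_set Ky)).
have tE : (a + b) * t = a by rewrite mulrC divfK// gt_eqF.
by rewrite scalerDr !scalerA mulrBr mulr1 tE addrAC subrr add0r.
Qed.

Section DotProduct.
Context {R : realType} {n : nat}.
Implicit Types (x y u v : 'rV[R]_n) (U V : {vspace 'rV[R]_n}).

Lemma dotDl x y v : dot (x + y) v = dot x v + dot y v.
Proof. by rewrite /dot mulmxDl mxE. Qed.

Lemma dotZl a x v : dot (a *: x) v = a * dot x v.
Proof. by rewrite /dot -scalemxAl mxE. Qed.

Lemma dotNr x v : dot x (- v) = - dot x v.
Proof. by rewrite /dot linearN /= mulmxN mxE. Qed.

Lemma dotNl x v : dot (- x) v = - dot x v.
Proof. by rewrite /dot mulNmx mxE. Qed.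

Lemma dotC x y : dot x y = dot y x.
Proof. by rewrite /dot -[in LHS](trmxK x) -trmx_mul mxE. Qed.

Lemma dot_eq0 x : dot x x = 0 -> x = 0.
Proof.
rewrite /dot mxE => /eqP; rewrite psumr_eq0 => [/allP x0|i _]; last first.
  by rewrite mxE -expr2 sqr_ge0.
apply/rowP => i; have := x0 i (mem_index_enum i).
by rewrite !mxE mulf_eq0 orbb => /eqP.
Qed.

(** Taking scalar products with a basis of [U] is injective on [U], because the
scalar product is definite, so by dimension every tuple of values is attained
there. *)
Lemma riesz_in_subspace U (f : {scalar 'rV[R]_n}) :
  exists2 v, v \in U & forall x, x \in U -> dot x v = f x.
Proof.
pose B := \matrix_(i < \dim U) (vbasis U)`_i.
pose phi := linfun (mulmxr B^T) : 'Hom('rV[R]_n, 'rV[R]_(\dim U)).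
have phiE v i : phi v 0 i = dot (vbasis U)`_i v.
  rewrite lfunE /= dotC /dot !mxE; apply: eq_bigr => j _.
  by rewrite !mxE.
have dot_vbasis v w x : phi v = w -> x \in U ->
    dot x v = \sum_i coord (vbasis U) i x * w 0 i.
  move=> <- xU; rewrite [X in dot X _](coord_vbasis xU).
  elim/big_rec2: _ => [|i a y _ <-]; first by rewrite /dot mul0mx mxE.
  by rewrite dotDl dotZl phiE.
have phi_inj : (U :&: lker phi = 0)%VS.
  apply/eqP; rewrite -subv0; apply/subvP => x /memv_capP[xU].
  rewrite memv_ker => /eqP phix0; rewrite memv0; apply/eqP/dot_eq0.
  rewrite (dot_vbasis _ _ _ phix0 xU) big1 // => i _.
  by rewrite mxE mulr0.
have phi_onto : (phi @: U = fullv)%VS.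
  apply/eqP; rewrite eqEdim subvf (limg_dim_eq phi_inj) dimvf.
  by rewrite /dim /= mul1n.
have /memv_imgP[v vU phiv] : \row_i f (vbasis U)`_i \in (phi @: U)%VS.
  by rewrite phi_onto memvf.
exists v => // x xU; rewrite (dot_vbasis _ _ _ (esym phiv) xU).
rewrite [in RHS](coord_vbasis xU) linear_sum.
by apply: eq_bigr => i _; rewrite linearZ /= mxE.
Qed.

End DotProduct.

(** The last property holds because [W + <[x]>] is strictly larger than [W]:
by maximality of the dimension it can no longer miss [K]. *)
Lemma maximal_disjoint_subspace {R : realType} {E : vectType R} (K : set E)
    (V : {vspace E}) :
  [set` V] `&` K = set0 ->
  exists W : {vspace E}, [/\ (V <= W)%VS, [set` W] `&` K = set0 &
    forall x, x \notin W -> exists2 k, K k & k \in (W + <[x]>)%VS].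
Proof.
move=> VK.
pose P d := `[< exists W : {vspace E},
  [/\ (V <= W)%VS, [set` W] `&` K = set0 & \dim W = d] >].
have exP : exists d, P d by exists (\dim V); apply/asboolP; exists V.
have bndP d : P d -> (d <= dim E)%N.
  by move=> /asboolP[W [_ _ <-]]; rewrite -dimvf dimvS ?subvf.
case: (ex_maxnP exP bndP) => _ /asboolP[W [VW WK <-]] W_max.
exists W; split=> // x xW; apply: contrapT => noK.
have /W_max : P (\dim (W + <[x]>)).
  apply/asboolP; exists (W + <[x]>)%VS; split=> //.
    exact: subv_trans (addvSl _ _).
  by rewrite -subset0 => k [/= kWx Kk]; apply: noK; exists k.
have := dimv_leqif_sup (addvSl W <[x]>); move=> /geq_leqif ->.
by rewrite subv_add subvv -memvE (negPf xW).
Qed.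

(** The representing vector can be taken nonzero in [U]: a functional vanishing
on [K] and on [W] vanishes on the cone [W + cone K], hence everywhere as this
cone is total. *)
Lemma separation {R : realType} {n : nat} (K : set 'rV[R]_n)
    (U V : {vspace 'rV[R]_n}) :
  convex_set K -> K !=set0 -> K `<=` [set` U] -> (V <= U)%VS ->
  [set` V] `&` K = set0 ->
  exists v, [/\ v \in U, v != 0, forall x, x \in V -> dot x v = 0 &
    forall k, K k -> dot k v <= 0].
Proof.
move=> cK [k0 Kk0] KU VU VK.
have [W [VW WK W_max]] := maximal_disjoint_subspace VK.
have KnW k : K k -> k \notin W.
  by move=> Kk; apply/negP => kW; have : set0 k by rewrite -WK.
(* The cone [W + cone K]; allowing [t = 0] is what includes [W] itself. *)
pose Q := [set x | exists t k, [/\ 0 <= t, K k & x - t *: k \in W]].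
have WQ x : x \in W -> Q x.
  by move=> xW; exists 0, k0; rewrite scale0r subr0.
have KQ k : K k -> Q k.
  by move=> Kk; exists 1, k; rewrite scale1r subrr mem0v.
have QD x y : Q x -> Q y -> Q (x + y).
  move=> [t [k [t0 Kk xW]]] [s [l [s0 Kl yW]]].
  have := addr_ge0 t0 s0; rewrite le0r => /orP[|ts].
    rewrite paddr_eq0// => /andP[/eqP tE /eqP sE].
    move: xW yW; rewrite tE sE !scale0r !subr0 => xW yW.
    by apply: WQ; apply: memvD.
  have [m Km mE] := convex_comb cK Kk Kl t0 s0 ts.
  exists (t + s), m; split; [exact: ltW|by []|].
  by rewrite -mE opprD addrACA memvD.
have QZ a x : 0 <= a -> Q x -> Q (a *: x).
  move=> a0 [t [k [t0 Kk xW]]]; exists (a * t), k; split=> //.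
    exact: mulr_ge0.
  by rewrite -scalerA -scalerBr memvZ.
have Q_total x : Q x \/ Q (- x).
  have [xW|/W_max[k Kk /memv_addP[w wW [_ /vlineP[s ->] kE]]]] := boolP (x \in W).
    by left; apply: WQ.
  (* [k = w + s *: x] puts [x] or [- x] in the cone according to the sign of
     [s], and [s = 0] would place [k] in [W]. *)
  have [s0|s0|s0] := ltrgtP s 0.
  - right; exists (- s^-1), k; split=> //; first by rewrite oppr_ge0 invr_le0 ltW.
    rewrite kE scaleNr opprK scalerDr scalerA mulVf ?lt_eqF// scale1r.
    by rewrite addrCA addNr addr0 memvZ.
  - left; exists s^-1, k; split=> //; first by rewrite invr_ge0 ltW.
    rewrite kE scalerDr scalerA mulVf ?gt_eqF// scale1r.
    by rewrite opprD addrCA subrr addr0 memvN memvZ.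
  - by move: (KnW _ Kk); rewrite kE s0 scale0r addr0 wW.
have [|f f_ge0 [e fe]] := total_cone_functional QD QZ Q_total.
  (* [- k0] in the cone would give a convex combination of [k0] and [k] in [W]. *)
  exists (- k0) => -[t [k [t0 Kk kW]]].
  have t1 : 0 < 1 + t by rewrite ltr_wpDr.
  have [m Km mE] := convex_comb cK Kk0 Kk ler01 t0 t1.
  have := KnW m Km; rewrite -[m](scalerK (lt0r_neq0 t1)) -mE scale1r.
  by rewrite memvZ// -memvN opprD.
have fW x : x \in W -> f x = 0.
  move=> xW; apply/eqP; rewrite eq_le f_ge0 ?andbT; last exact: WQ.
  by rewrite -oppr_ge0 -raddfN f_ge0//; apply: WQ; rewrite memvN.
have [v vU vE] := riesz_in_subspace U f.
exists (- v); split; first by rewrite memvN.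
- rewrite oppr_eq0; apply/eqP => v0.
  have fQ x : Q x -> f x = 0.
    move=> [t [k [_ Kk /fW]]]; rewrite linearB linearZ /= -(vE k); last exact: KU.
    by rewrite v0 /dot trmx0 mulmx0 mxE mulr0 subr0.
  case/eqP: fe; case: (Q_total e) => [|/fQ]; first exact: fQ.
  by rewrite linearN => /eqP; rewrite oppr_eq0 => /eqP.
- by move=> x xV; rewrite dotNr vE ?fW ?oppr0//; apply: (subvP _ _) xV.
- move=> k Kk; rewrite dotNr vE; last exact: KU.
  by rewrite oppr_le0 f_ge0//; apply: KQ.
Qed.

(** * Supporting subspaces *)

Section SupportingSubspaces.
Context {R : realType} {n : nat} (C S : set 'rV[R]_n) (s0 : 'rV[R]_n).
Hypotheses (convC : convex_set C) (SC : S `<=` C) (Ss0 : S s0).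
Implicit Types U V : {vspace 'rV[R]_n}.

Lemma mem_set_sum U x :
  set_diff S S `<=` [set` U] -> set_sum [set` U] S x <-> x - s0 \in U.
Proof.
move=> SU; split=> [[u uU [s Ss <-]]|xU].
  by rewrite -addrA memvD//; apply: SU; exists s => //; exists s0.
by exists (x - s0) => //; exists s0; rewrite ?subrK.
Qed.

(** Suppose that an interior point of a segment of [C] lies in
[U :&: orthv v + S] while the ends do not.  The ends are both in [U + S] or
both outside it; the latter contradicts [U] being supporting, and in the former
case [v] is strictly negative at both ends, hence also in between. *)
Lemma supporting_cap_orthv U v :
  supporting_subspaces C S U -> nested_normal_cone C U S v ->
  supporting_subspaces C S (U :&: orthv v)%VS.
Proof.
move=> [SU /convex_setP cCU] [vU v_le].
have dot_le s t : S s -> S t -> dot (s - t) v <= 0.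
  move=> Ss St; apply: v_le => //; split; first exact: SC.
  by apply/mem_set_sum => //; apply: SU; exists s => //; exists s0.
have SUv : set_diff S S `<=` [set` (U :&: orthv v)%VS].
  move=> _ [s Ss [t St <-]] /=; rewrite memv_cap mem_orthv eq_le dot_le//=.
  rewrite -[X in 0 <= X]opprK -dotNl opprB oppr_ge0 dot_le// andbT.
  by apply: SU; exists s => //; exists t.
split=> //; apply/convex_setP => x y t t01 [Cx nx] [Cy ny].
have [t0 t1] := andP t01; have t1' : 0 < 1 - t by rewrite subr_gt0.
split; first by move/convex_setP: convC; apply.
have zE : t *: x + (1 - t) *: y - s0 = t *: (x - s0) + (1 - t) *: (y - s0).
  by rewrite !scalerBr addrACA -opprD -scalerDl addrCA subrr addr0 scale1r.
move=> /(mem_set_sum _ SUv); rewrite zE memv_cap mem_orthv dotDl !dotZl => /andP[zU /eqP z0].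
have dot_lt w : C w -> ~ set_sum [set` (U :&: orthv v)%VS] S w ->
    w - s0 \in U -> dot (w - s0) v < 0.
  move=> Cw nw wU; rewrite lt_neqAle v_le// ?andbT; last first.
    by split=> //; apply/mem_set_sum.
  apply/negP => w0; apply: nw; apply/mem_set_sum => //.
  by rewrite memv_cap wU mem_orthv.
have [xU|xU] := boolP (x - s0 \in U).
  have yU : y - s0 \in U.
    rewrite -[y - s0](scalerK (lt0r_neq0 t1')) memvZ//.
    by move: zU; rewrite rpredDl// memvZ.
  have : t * dot (x - s0) v + (1 - t) * dot (y - s0) v < 0.
    by rewrite -[ltRHS]addr0 ltrD// pmulr_rlt0// dot_lt.
  by rewrite z0 ltxx.
have [yU|yU] := boolP (y - s0 \in U).
  move/negP: xU; apply; rewrite -[x - s0](scalerK (lt0r_neq0 t0)) memvZ//.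
  by move: zU; rewrite rpredDr// memvZ.
have nU w : w - s0 \notin U -> ~ set_sum [set` U] S w.
  by move=> /negP wU /(mem_set_sum _ SU).
have [_] := cCU x y t t01 (conj Cx (nU _ xU)) (conj Cy (nU _ yU)).
by apply; apply/mem_set_sum; rewrite ?zE.
Qed.

(** Separation is applied to the part of [C - s0] in [U] away from [V], whose
convexity is what it means for [V] to be supporting. *)
Lemma exists_normal_descent U V :
  supporting_subspaces C S V -> (V <= U)%VS -> ~~ (U <= V)%VS ->
  exists v, [/\ nested_normal_cone C U S v, v != 0 & (V <= orthv v)%VS].
Proof.
move=> [SV /convex_setP cCV] VU /subvPn[u uU uV].
pose K := [set x | [/\ x \in U, x \notin V & C (x + s0)]].
have cK : convex_set K.
  apply/convex_setP => x y t t01 [xU xV Cx] [yU yV Cy].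
  have nV z : z \notin V -> ~ set_sum [set` V] S (z + s0).
    by move=> /negP zV /(mem_set_sum _ SV); rewrite addrK.
  have [] := cCV _ _ t t01 (conj Cx (nV _ xV)) (conj Cy (nV _ yV)).
  have -> : t *: (x + s0) + (1 - t) *: (y + s0) = t *: x + (1 - t) *: y + s0.
    by rewrite !scalerDr addrACA -scalerDl addrCA subrr addr0 scale1r.
  move=> Cz /(mem_set_sum _ SV) zV; split=> //; first by rewrite memvD ?memvZ.
  by rewrite addrK in zV; apply/negP.
(* Separation needs a nonempty set: if [K] is empty, a point of [U] outside [V]
   is used, just to get some nonzero vector of [U] orthogonal to [V]. *)
have [K' [cK' K'0 K'U VK' KK']] : exists K', [/\ convex_set K', K' !=set0,
    K' `<=` [set` U], [set` V] `&` K' = set0 & K `<=` K'].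
  have [K0|/eqP K0] := eqVneq K set0; last first.
    exists K; split=> //; first exact/set0P/eqP.
      by move=> x [].
    by rewrite -subset0 => x [/= xV [_ /negP]].
  exists [set u]; split; first 1 last.
  - by exists u.
  - by move=> _ ->.
  - by rewrite -subset0 => x [/= xV xu]; case/negP: uV; rewrite -xu.
  - by rewrite K0.
  apply/convex_setP => x y t _ -> -> /=.
  by rewrite -scalerDl addrCA subrr addr0 scale1r.
have [v [vU v0 vV vK]] := separation cK' K'0 K'U VU VK'.
have SU : set_diff S S `<=` [set` U] by move=> x /SV; apply: (subvP VU).
exists v; split=> //; last first.
  by apply/subvP => x xV; rewrite mem_orthv vV.
split=> // c [Cc /(mem_set_sum _ SU) cU] s Ss.
rewrite -(subrKA s0) dotDl [X in _ + X]vV ?addr0; last first.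
  by apply: SV; exists s0 => //; exists s.
have [cV|cV] := boolP (c - s0 \in V); first by rewrite vV.
by apply/vK/KK'; split; rewrite ?subrK.
Qed.

End SupportingSubspaces.

Theorem corollary6p1 (R : realType) (n : nat) (C S : set 'rV[R]_n)
    (A : {vspace 'rV[R]_n} -> Prop) :
  convex_set C ->
  S `<=` C ->
  S !=set0 ->
  A fullv ->
  (forall U, supporting_subspaces C S U ->
   forall v, nested_normal_cone C U S v ->
   A U -> A (U :&: orthv v)%VS) ->
  forall V, supporting_subspaces C S V -> A V.
Proof.
move=> convC SC [s0 Ss0] A_full A_cap V suppV.
suff descend m U : (\dim U < m)%N -> supporting_subspaces C S U ->
    (V <= U)%VS -> A U -> A V.
  apply: (descend (\dim {:'rV[R]_n}).+1 fullv) => //; last exact: subvf.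
  split=> [x _|]; first exact: memvf.
  apply/convex_setP => x y t _ [_ nx] _; case: nx.
  by exists (x - s0); [exact: memvf | exists s0; rewrite ?subrK].
elim: m U => // m IHm U dimU suppU VU AU.
have [UV|UV] := boolP (U <= V)%VS.
  by have -> : V = U by apply/eqP; rewrite eqEsubv VU.
have [v [vN v0 Vv]] := exists_normal_descent Ss0 suppV VU UV.
apply: (IHm (U :&: orthv v)%VS); last exact: A_cap.
- rewrite ltnS in dimU; apply: leq_trans dimU; have := dimv_leqif_sup (capvSl U (orthv v)).
  move=> /ltn_leqif ->; rewrite subv_cap subvv/=.
  apply: contra v0 => /subvP/(_ v); rewrite mem_orthv.
  by case: vN => vU _ /(_ vU) /eqP /dot_eq0 ->.
- exact: supporting_cap_orthv Ss0 _ _ suppU vN.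
- by rewrite subv_cap VU.
Qed.
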